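(* Let $E$ be a set and let $\mathcal{B}$ be a set of subsets of $E$ different from $\emptyset$ and $E$ that is closed under taking complements and such that if $S$ and $T$ are crossing elements of $\mathcal{B}$ then $S\cup T\in\mathcal{B}$. Let $\mathcal{V}$, $\mathcal{E}'$, $\mathcal{B}'$ and the consistent orientations $O_X$ of $\mathcal{E}'$ (for $X\in\mathcal{V}\cup E$) be as defined in the context. Let $X$ and $Y$ be distinct elements of the (disjoint) union $\mathcal{V}\cup E$. Then either the consistent orientations $O_X$ and $O_Y$ of $\mathcal{E}'$ are distinct, or $X$ and $Y$ are both elements of $E$ and there is no element of $\mathcal{B}'$ which contains only one of $X$ and $Y$.
   Context: Two subsets $A,B$ of $E$ are nested if $A\subseteq B$ or $B\subseteq A$ or $A\cap B=\emptyset$ or $A\cup B=E$; otherwise they cross. A set $A$ points towards a set $B$ if $A\subseteq B$ or $A\subseteq E\setminus B$. The orientations of $A$ are $A$ and $E\setminus A$. $\mathcal{E}$ is the set of all elements of $\mathcal{B}$ that do not cross any element of $\mathcal{B}$. $\mathcal{V}$ is the finest partition of $\mathcal{B}\setminus\mathcal{E}$ such that elements of distinct partition classes are nested (so its elements are the connected components of the crossing relation on $\mathcal{B}\setminus\mathcal{E}$). For $V\in\mathcal{V}$ let $\sim_V$ be the equivalence relation on $E$ with $e\sim_V f$ if and only if no element of $V$ contains exactly one of $e$ and $f$; $\partial(V)$ denotes the set of equivalence classes of $\sim_V$. Let $$\mathcal{E}'=\mathcal{E}\cup\bigcup_{V\in\mathcal{V}}\{A,E\setminus A: A\in\partial(V)\},\qquad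 \mathcal{B}'=\mathcal{B}\cup\mathcal{E}'.$$ A consistent orientation of $\mathcal{E}'$ is a subset $O\subseteq\mathcal{E}'$ that contains exactly one of $A$ and $E\setminus A$ for every $A\in\mathcal{E}'$ and such that $R\subsetneq S\in O$ and $R\in\mathcal{E}'$ imply $R\in O$. For $V\in\mathcal{V}$, $O_V$ is the set of those elements of $\mathcal{E}'$ which point towards all elements of $V$; for $e\in E$, $O_e$ is the set of those elements of $\mathcal{E}'$ which do not contain $e$. These are consistent orientations of $\mathcal{E}'$. *)

(* Defs.v *)
From mathcomp Require Import all_boot.
From mathcomp Require Import boolp classical_sets.
From Stdlib Require Import Relations.

Set Implicit Arguments.
Unset Strict Implicit.
Unset Printing Implicit Defensive.

Local Open Scope classical_set_scope.

(* The ground set is a type [E], so that [setT] is the paper's E and [~` A] is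
   the complement of A in E.  [E] may be infinite or empty. *)

Definition nested (E : Type) (A B : set E) : Prop :=
  [\/ A `<=` B, B `<=` A, A `&` B = set0 | A `|` B = setT].

Definition cross (E : Type) (A B : set E) : Prop := ~ nested A B.

Definition points_towards (E : Type) (A B : set E) : Prop :=
  A `<=` B \/ A `<=` ~` B.

Definition contains_exactly_one (E : Type) (S : set E) (e f : E) : Prop :=
  (S e /\ ~ S f) \/ (S f /\ ~ S e).

Definition calE (E : Type) (B : set (set E)) : set (set E) :=
  [set A | B A /\ forall S, B S -> ~ cross A S].

Definition nested_partition (E : Type) (B : set (set E))
    (P : set (set (set E))) : Prop :=
  partition P id (B `\` calE B) /\
  forall V W, P V -> P W -> V <> W ->
    forall S T, V S -> W T -> nested S T.

Definition refines (T : Type) (P Q : set (set T)) : Prop :=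
  forall V, P V -> exists2 W, Q W & V `<=` W.

Definition finest_nested_partition (E : Type) (B : set (set E))
    (P : set (set (set E))) : Prop :=
  nested_partition B P /\ forall Q, nested_partition B Q -> refines P Q.

(* The finest nested partition; the default [set0] is never used, because such
   a partition always exists and is unique: see [calV_finest] and
   [finest_nested_partition_unique]. *)
Definition calV (E : Type) (B : set (set E)) : set (set (set E)) :=
  xget set0 (finest_nested_partition B).

Definition sim (E : Type) (V : set (set E)) (e f : E) : Prop :=
  ~ exists2 S, V S & contains_exactly_one S e f.

Definition boundary (E : Type) (V : set (set E)) : set (set E) :=
  range (fun e => [set f | sim V e f]).

Definition calE' (E : Type) (B : set (set E)) : set (set E) :=
  calE B `|`
  \bigcup_(V in calV B) (boundary V `|` [set ~` A | A in boundary V]).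

Definition calB' (E : Type) (B : set (set E)) : set (set E) := B `|` calE' B.

Definition orientation_class (E : Type) (B : set (set E)) (V : set (set E)) :
    set (set E) :=
  [set A | calE' B A /\ forall S, V S -> points_towards A S].

Definition orientation_point (E : Type) (B : set (set E)) (e : E) :
    set (set E) :=
  [set A | calE' B A /\ ~ A e].

Definition orientation (E : Type) (B : set (set E)) (X : calV B + E) :
    set (set E) :=
  match X with
  | inl V => orientation_class B (val V)
  | inr e => orientation_point B e
  end.

Lemma finest_nested_partition_unique (E : Type) (B : set (set E)) P Q :
  finest_nested_partition B P -> finest_nested_partition B Q -> P = Q.
Proof.
suff H P1 Q1 : finest_nested_partition B P1 -> finest_nested_partition B Q1 ->
    P1 `<=` Q1 by move=> hP hQ; apply/seteqP; split; apply: H.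
move=> [nP fP] [nQ fQ] V PV.
have [W QW VW] := fP _ nQ V PV.
have [V' PV' WV'] := fQ _ nP W QW.
have [[_ tP neP] _] := nP.
have [S VS] := neP _ PV.
have VV' : V = V' by apply: tP => //; exists S; split=> //; apply/WV'/VW.
by suff -> : V = W by []; apply/seteqP; split=> //; rewrite {1}VV'.
Qed.

Lemma calV_finest (E : Type) (B : set (set E)) :
  finest_nested_partition B (calV B).
Proof.
apply: xgetPex; pose D := B `\` calE B.
pose r S T := [/\ D S, D T & cross S T].
pose c := clos_refl_sym_trans _ r.
have cD S T : c S T -> D S <-> D T.
  by elim=> {S T} [S T []|S|S T _|S T U _ h1 _ h2] //; [tauto|rewrite h1].
exists [set V | exists2 S, D S & V = [set T | c S T]]; split; first split.
- split.
  + apply/seteqP; split=> [T [_ [S DS ->]] /= /cD h|S DS]; first exact/h.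
    by exists [set T | c S T]; [exists S|exact: rst_refl].
  + move=> _ _ [S DS ->] [T DT ->] [U /= [SU TU]].
    have ST : c S T by apply: rst_trans SU _; exact: rst_sym.
    apply/seteqP; split=> W /= h; last exact: rst_trans h.
    by apply: rst_trans h; exact: rst_sym.
  + by move=> _ [S DS ->]; exists S; exact: rst_refl.
- move=> _ _ [S DS ->] [T DT ->] VW S' T' /= SS' TT'.
  apply: contrapT => X; apply: VW.
  have ST : c S T.
    apply: (@rst_trans _ _ _ S') => //; apply: (@rst_trans _ _ _ T');
      last exact: rst_sym.
    by apply: rst_step; split=> //; [exact/(cD _ _ SS')|exact/(cD _ _ TT')].
  apply/seteqP; split=> W /= h; last exact: rst_trans h.
  by apply: rst_trans h; exact: rst_sym.
- move=> Q [[cQ tQ neQ] nQ] _ [S DS ->].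
  have QD T : D T -> exists2 W, Q W & W T by rewrite /D -cQ => -[W]; exists W.
  have [W QW WS] := QD _ DS; exists W => // T /= cST.
  suff : forall S T, c S T -> forall W, Q W -> W S <-> W T.
    by move=> /(_ _ _ cST _ QW) [/(_ WS)].
  move=> {DS cST W QW WS} {}S {}T.
  elim=> {S T} [S T [DS DT X]|S|S T _ h|S T U _ h1 _ h2] W QW //.
  + have [W1 QW1 W1S] := QD _ DS; have [W2 QW2 W2T] := QD _ DT.
    have E12 : W1 = W2 by apply: contrapT => /(nQ _ _ QW1 QW2) /(_ _ _ W1S W2T).
    subst W2; split=> h.
    * by rewrite (tQ W W1) //; exists S.
    * by rewrite (tQ W W1) //; exists T.
  + by split=> /(h _ QW).
  + by rewrite (h1 _ QW) (h2 _ QW).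
Qed.

(* Main.v *)
Require Import Defs.
From mathcomp Require Import all_boot.
From mathcomp Require Import boolp classical_sets.

Local Open Scope classical_set_scope.

(** A class of [sim V] points towards every element of [V].  This already
    settles the cases involving a point.  The class of [e] lies in the
    orientation of [V] but not in that of [e].  If an element of [B] separates
    [e] from [f], then either it is in [calE B], or it is in some [V] of
    [calV B] and the class of [e] under [sim V] separates [e] from [f] too; in
    both cases an element of [calE' B] separates the two orientations.

    The case of two distinct crossing components [V] and [W] rests on
    connectedness: a property that passes along crossing pairs and holds for one
    element of a component holds for all of them
    ([crossing_closed_propagates]).
    An element [S] of [V] is nested with all elements of [W], so [S] or its
    complement points towards each of them, and the choice of side propagates
    along crossings in [W] ([side_points_towards_class]).  Hence one side of [S]
    is contained in a class [A] of [sim W].  Since crossing sets have four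
    nonempty corners, sides of two crossing elements of [V] always meet, so they
    are contained in the same class; thus a single [A] contains a side of every
    element of [V] ([class_absorbing_sides]).  This says that [~` A] points
    towards every element of [V].  It does not point towards all of [W]: with
    [A] and [~` A] both doing so, two crossing elements of [W] would have at most
    two nonempty corners. *)

(** * Crossing sets and pointing *)

Lemma crossC {E : Type} {S T : set E} : cross S T -> cross T S.
Proof.
move=> X N; apply: X; case: N => h.
- exact: Or42.
- exact: Or41.
- by apply: Or43; rewrite setIC.
- by apply: Or44; rewrite setUC.
Qed.

Lemma cross_corners {E : Type} {S T : set E} : cross S T ->
  [/\ exists x, S x /\ T x, exists x, S x /\ ~ T x,
      exists x, ~ S x /\ T x & exists x, ~ S x /\ ~ T x].
Proof.
move=> X; split; apply: contrapT => N; apply: X.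
- apply: Or43; apply/seteqP; split=> // x [Sx Tx].
  by apply: N; exists x.
- apply: Or41 => x Sx; apply: contrapT => Tx.
  by apply: N; exists x.
- apply: Or42 => x Tx; apply: contrapT => Sx.
  by apply: N; exists x.
- apply: Or44; apply/seteqP; split=> // x _; apply: contrapT => /not_orP ?.
  by apply: N; exists x.
Qed.

(** This form treats the two alternatives of [points_towards] uniformly, and
    says that pointing towards [T] is lying inside one class of the partition
    of the ground set into [T] and its complement. *)
Lemma points_towardsP {E : Type} (A T : set E) :
  points_towards A T <-> forall x y, A x -> A y -> T x -> T y.
Proof.
split=> [[] AT x y Ax Ay Tx|h]; first exact: AT.
  by case: (AT x Ax).
have [[x [Ax Tx]]|N] := pselect (exists x, A x /\ T x).
  by left=> y Ay; exact: h Tx.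
by right=> x Ax Tx; apply: N; exists x.
Qed.

Lemma nested_side_points_towards {E : Type} {S T : set E} :
  nested S T -> points_towards S T \/ points_towards (~` S) T.
Proof.
case=> h.
- by left; left.
- by right; right=> x Sx /h.
- left; right=> x Sx Tx.
  by have : (S `&` T) x by []; rewrite h.
- right; left=> x Sx.
  by have [] : (S `|` T) x by rewrite h.
Qed.

(** A side of [T] and a side of [T'] that contain [R] and its complement cover
    the ground set, so the corner opposite to them is empty. *)
Lemma points_towards_opposite_nested {E : Type} {R T T' : set E} :
  points_towards R T -> points_towards (~` R) T' -> ~ cross T T'.
Proof.
move=> RT RT' /cross_corners [[a [aT aT']] [b [bT bT']] [c [cT cT']]
  [d [dT dT']]].
case: RT => RT; case: RT' => RT'.
- by have [/RT|/RT'] := pselect (R d).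
- by have [/RT|/RT'] := pselect (R c).
- by have [/RT|/RT'] := pselect (R b).
- by have [/RT|/RT'] := pselect (R a).
Qed.

(** * The equivalence relation of a set of sets *)

Lemma simP {E : Type} (V : set (set E)) (e f : E) :
  sim V e f <-> forall S, V S -> S e <-> S f.
Proof.
split=> [h S VS|h [S VS]]; last first.
  by have := h S VS; rewrite /contains_exactly_one; tauto.
split=> Sx; apply: contrapT => Sy; apply: h; exists S => //.
  by left.
by right.
Qed.

Lemma sim_class_points_towards {E : Type} {V : set (set E)} (e : E)
    {S : set E} : V S -> points_towards [set f | sim V e f] S.
Proof.
move=> VS; apply/points_towardsP => x y /simP/(_ _ VS) ex /simP/(_ _ VS) ey.
by rewrite -ex -ey.
Qed.

Lemma sim_refl {E : Type} (V : set (set E)) (e : E) : sim V e e.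
Proof. exact/simP. Qed.

Lemma sim_class_eq {E : Type} {V : set (set E)} {e f x : E} :
  sim V e x -> sim V f x -> [set y | sim V e y] = [set y | sim V f y].
Proof.
move=> /simP ex /simP fx.
apply/seteqP; split=> y /simP h; apply/simP => S VS.
  by rewrite (fx S VS) -(ex S VS); exact: h.
by rewrite (ex S VS) -(fx S VS); exact: h.
Qed.

Lemma points_towards_sub_class {E : Type} {V : set (set E)} {A : set E}
    {e : E} : A e -> (forall S, V S -> points_towards A S) ->
  A `<=` [set f | sim V e f].
Proof.
move=> Ae AV f Af; apply/simP => S /AV /points_towardsP AS.
by split; exact: AS.
Qed.

(** * Crossing components *)

Section Components.
Context {E : Type} {B : set (set E)}.
Implicit Types V W : set (set E).

Lemma calV_sub {V S} : calV B V -> V S -> B S /\ ~ calE B S.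
Proof.
have [[[cov _ _] _] _] := calV_finest B => VV VS.
by have : (B `\` calE B) S by rewrite -cov; exists V.
Qed.

Lemma calV_cover {S} : B S -> ~ calE B S -> exists2 V, calV B V & V S.
Proof.
have [[[cov _ _] _] _] := calV_finest B => BS ES.
have : (B `\` calE B) S by [].
by rewrite -cov => -[V VV VS]; exists V.
Qed.

Lemma calV_nested {V W S T} :
  calV B V -> calV B W -> V <> W -> V S -> W T -> nested S T.
Proof.
by have [[_ nest] _] := calV_finest B => VV WW VW; exact: nest.
Qed.

Lemma calV_nonempty {V} : calV B V -> exists S, V S.
Proof. by have [[[_ _ ne] _] _] := calV_finest B => /ne. Qed.

Lemma calV_cross_closed {V S T} :
  calV B V -> V S -> B T -> cross S T -> V T.
Proof.
move=> VV VS BT X.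
have [BS _] := calV_sub VV VS.
have [|W WW WT] := calV_cover BT.
  by move=> [_ /(_ _ BS)]; apply; exact: crossC.
have [-> //|VW] := pselect (V = W).
by case: X; exact: calV_nested VW VS WT.
Qed.

Lemma calV_crossed {V S} : calV B V -> V S -> exists2 T, V T & cross S T.
Proof.
move=> VV VS; have [BS ES] := calV_sub VV VS.
apply: contrapT => N; apply: ES; split=> // T BT X; apply: N.
by exists T => //; exact: calV_cross_closed X.
Qed.

(** Elements of [V] in [P] are nested with all other elements of
    [B `\` calE B], so these two sets, as far as they are nonempty, form a nested
    partition; as [calV B] refines it, [V] cannot meet both parts. *)
Lemma crossing_closed_propagates {V} (P : set (set E)) {S0} :
  calV B V -> V S0 -> P S0 ->
  (forall S T, V S -> V T -> cross S T -> P S -> P T) ->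
  forall S, V S -> P S.
Proof.
move=> VV VS0 PS0 step.
pose D := B `\` calE B.
pose Q := [set U : set (set E) | (exists S, U S) /\
  (U = D `&` (V `&` P) \/ U = D `\` (V `&` P))].
have apart S T : (D `&` (V `&` P)) S -> (D `\` (V `&` P)) T -> nested S T.
  move=> [_ [VS PS]] [[BT _] NT]; apply: contrapT => X; apply: NT.
  have VT : V T by exact: calV_cross_closed X.
  by split=> //; exact: step PS.
have nestedQ : nested_partition B Q.
  split; first split.
  - apply/seteqP; split=> [S [U [_ [] -> []]] //|S DS].
    have [VPS|NS] := pselect ((V `&` P) S).
      by exists (D `&` (V `&` P)) => //; split; [exists S|left].
    by exists (D `\` (V `&` P)) => //; split; [exists S|right].
  - by move=> U U' [_ []->] [_ []->] // [S] /= [[? h] [? h']].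
  - by move=> U [].
  - move=> U U' [_ []->] [_ []->] UU' S T hS hT; try by case: UU'.
      exact: apart.
    by apply: contrapT => /crossC; apply; exact: apart.
have [U [_ UE] VU] := (calV_finest B).2 _ nestedQ _ VV.
case: UE VU => -> VU S VS; first by have [_ []] := VU S VS.
by have [_ []] := VU S0 VS0.
Qed.

(** * Two distinct components *)

(** By [points_towards_opposite_nested] the choice between [R] and its complement
    cannot change along a crossing pair. *)
Lemma points_towards_propagates {W} {R : set E} {T0} :
  calV B W -> (forall T, W T -> points_towards R T \/ points_towards (~` R) T) ->
  W T0 -> points_towards R T0 -> forall T, W T -> points_towards R T.
Proof.
move=> WW side WT0 RT0.
apply: (crossing_closed_propagates (points_towards R) WW WT0 RT0).
move=> T T' WT WT' X RT; have [//|RT'] := side _ WT'.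
by case: (points_towards_opposite_nested RT RT' X).
Qed.

Lemma side_points_towards_class {V W S} :
  calV B V -> calV B W -> V <> W -> V S ->
  exists e, S `<=` [set f | sim W e f] \/ ~` S `<=` [set f | sim W e f].
Proof.
move=> VV WW VW VS.
have [S' _ /cross_corners [[a [Sa _]] _ [c [Sc _]] _]] := calV_crossed VV VS.
have side T : W T -> points_towards S T \/ points_towards (~` S) T.
  by move=> WT; apply: nested_side_points_towards; exact: calV_nested VW VS WT.
have [T0 WT0] := calV_nonempty WW.
have [ST0|ST0] := side _ WT0.
  exists a; left; apply: (points_towards_sub_class Sa).
  exact: points_towards_propagates ST0.
exists c; right; apply: (points_towards_sub_class (A := ~` S) Sc).
apply: points_towards_propagates ST0 => // T /side.
by rewrite setCK => -[]; [right|left].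
Qed.

(** Any side of [S] meets any side of a set crossing [S], so the classes
    containing sides of crossing elements of [V] coincide. *)
Lemma class_absorbing_sides {V W} :
  calV B V -> calV B W -> V <> W ->
  exists e, forall S, V S ->
    S `<=` [set f | sim W e f] \/ ~` S `<=` [set f | sim W e f].
Proof.
move=> VV WW VW; have [S0 VS0] := calV_nonempty VV.
have [e eS0] := side_points_towards_class VV WW VW VS0.
exists e.
apply: (crossing_closed_propagates
  [set S | S `<=` [set f | sim W e f] \/ ~` S `<=` [set f | sim W e f]]
  VV VS0 eS0) => S T VS VT X /= eS.
have [e' eT] := side_points_towards_class VV WW VW VT.
suff [x ex e'x] : exists2 x, sim W e x & sim W e' x.
  by rewrite (sim_class_eq ex e'x).
have [[a [aS aT]] [b [bS bT]] [c [cS cT]] [d [dS dT]]] := cross_corners X.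
case: eS => eS; case: eT => eT.
- by exists a; [exact: eS|exact: eT].
- by exists b; [exact: eS|exact: eT].
- by exists c; [exact: eS|exact: eT].
- by exists d; [exact: eS|exact: eT].
Qed.

(** The class [A] points towards all elements of [W] itself.  If its complement
    did too, [A] and [~` A] would each lie in a single corner of any two
    crossing elements of [W], although three of the corners are inhabited. *)
Lemma co_class_not_pointing {W} (e : E) : calV B W ->
  ~ forall T, W T -> points_towards (~` [set f | sim W e f]) T.
Proof.
move=> WW co; set A := [set f | sim W e f] in co.
have cl T : W T -> points_towards A T by exact: sim_class_points_towards.
have [T WT] := calV_nonempty WW.
have [T' WT' /cross_corners [[a [aT aT']] [b [bT bT']] [c [cT cT']] _]] :=
  calV_crossed WW WT.
have same x y : (A x <-> A y) -> (T x -> T y) /\ (T' x -> T' y).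
  move=> xy; have [Ax|Ax] := pselect (A x).
    have Ay : A y by exact/xy.
    by split; [move/points_towardsP: (cl _ WT)|move/points_towardsP: (cl _ WT')];
      apply.
  have Ay : (~` A) y by move=> /xy.
  by split; [move/points_towardsP: (co _ WT)|move/points_towardsP: (co _ WT')];
    apply.
have ab : ~ (A a <-> A b) by move=> /same [_ /(_ aT')].
have ac : ~ (A a <-> A c) by move=> /same [/(_ aT)].
have bc : ~ (A b <-> A c) by move=> /same [/(_ bT)].
by have [] := pselect (A a); have [] := pselect (A b); have [] := pselect (A c);
  tauto.
Qed.

(** * Comparing the orientations *)

Lemma boundary_calE' {V} (e : E) :
  calV B V -> calE' B [set f | sim V e f].
Proof. by move=> VV; right; exists V => //; left; exists e. Qed.

Lemma co_boundary_calE' {V} (e : E) :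
  calV B V -> calE' B (~` [set f | sim V e f]).
Proof.
move=> VV; right; exists V => //; right.
by exists [set f | sim V e f] => //; exists e.
Qed.

Lemma orientation_class_neq_point {V} (e : E) :
  calV B V -> orientation_class B V <> orientation_point B e.
Proof.
move=> VV OVe.
have : orientation_class B V [set f | sim V e f].
  by split; [exact: boundary_calE'|move=> S; exact: sim_class_points_towards].
by rewrite OVe => -[_]; apply; exact: sim_refl.
Qed.

Lemma orientation_class_inj {V W} : calV B V -> calV B W ->
  orientation_class B V = orientation_class B W -> V = W.
Proof.
move=> VV WW OVW; apply: contrapT => VW.
have [e absorb] := class_absorbing_sides VV WW VW.
have : orientation_class B V (~` [set f | sim W e f]).
  split; first exact: co_boundary_calE'.
  move=> S /absorb [] h; first by right=> x + /h.
  by left=> x Ax; apply: contrapT => /h.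
by rewrite OVW => -[_]; exact: co_class_not_pointing.
Qed.

Lemma orientation_point_unseparated {e f : E} {S} :
  orientation_point B e = orientation_point B f -> calE' B S -> S e <-> S f.
Proof.
move=> Oef ES.
have h : orientation_point B e S <-> orientation_point B f S by rewrite Oef.
rewrite /orientation_point /= in h.
by have [] := pselect (S e); have [] := pselect (S f); tauto.
Qed.

Lemma calB'_unseparated {e f : E} {S} :
  (forall A, calE' B A -> A e <-> A f) -> calB' B S -> S e <-> S f.
Proof.
move=> unsep [BS|]; last exact: unsep.
have [ES|ES] := pselect (calE B S); first by apply: unsep; left.
have [V VV VS] := calV_cover BS ES.
have /simP ef : sim V e f.
  by apply/(unsep _ (boundary_calE' e VV)); exact: sim_refl.
exact: ef.
Qed.

End Components.

Theorem lemma9p22 (E : Type) (B : set (set E))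
  (B_proper : forall S, B S -> S <> set0 /\ S <> setT)
  (B_compl : forall S, B S -> B (~` S))
  (B_cross : forall S T, B S -> B T -> cross S T -> B (S `|` T))
  (X Y : calV B + E) (XY : X <> Y) :
  orientation X <> orientation Y \/
  exists e f : E, [/\ X = inr e, Y = inr f &
    ~ exists2 S, calB' B S & contains_exactly_one S e f].
Proof.
case: X Y XY => [V|e] [W|f] XY /=.
- left=> OVW; apply: XY; congr inl; apply: val_inj.
  by apply: orientation_class_inj OVW; exact: set_valP.
- by left; apply: orientation_class_neq_point; exact: set_valP.
- by left=> /esym; apply: orientation_class_neq_point; exact: set_valP.
- have [Oef|] := pselect (orientation_point B e = orientation_point B f);
    last by left.
  right; exists e, f; split=> // -[S BS].
  have ef : S e <-> S f.
    apply: calB'_unseparated BS => A; exact: orientation_point_unseparated.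
  by rewrite /contains_exactly_one; tauto.
Qed.
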